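(* Let $R$ be an integral domain of characteristic $0$, let $S\subset\mathbb{N}$ be a $\Leftrightarrow_R$-connected subset, and let $n\in S$. Assume that $R$ is $p$-adically separated for each odd prime factor $p$ of $n$, and also that if $4\mid n$ then $R$ is $2$-adically separated. Let $\zeta$ be a primitive $n$th root of unity (in an algebraic closure of the fraction field of $R$; it may or may not lie in $R$). Then the homomorphism $\sigma^R_{S,\zeta}\colon R[q]^S\to R[\zeta][[q-\zeta]]$ induced by the inclusion $R[q]\subset R[\zeta][q]$ is injective. In particular, for any root of unity $\zeta$ the homomorphism $\sigma^{\mathbb{Z}}_{\mathbb{N},\zeta}\colon\mathbb{Z}[q]^{\mathbb{N}}\to\mathbb{Z}[\zeta][[q-\zeta]]$ is injective.
   Context: All rings are commutative with unit; $q$ is an indeterminate. For $n\in\mathbb{N}$, $\Phi_n(q)$ is the $n$th cyclotomic polynomial. For $S\subset\mathbb{N}$, $\Phi_S^*$ is the multiplicative subset of $\mathbb{Z}[q]$ generated by $\{\Phi_m(q):m\in S\}$, directed by divisibility, and $R[q]^S=\varprojlim_{f\in\Phi_S^*}R[q]/(f)$. A ring $R$ is $p$-adically separated if $\bigcap_{j\ge0}p^jR=(0)$. For $m,m'\in\mathbb{N}$ write $m\Leftrightarrow_R m'$ if $m=m'$, or $m/m'$ is an integer power (positive or negative exponent) of a prime $p$ with $R$ $p$-adically separated, or $R=\{0\}$. A subset $S\subset\mathbb{N}$ is $\Leftrightarrow_R$-connected if it is nonempty and any two elements are joined by a finite chain in $S$ with consecutive elements related by $\Leftrightarrow_R$.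 The map $\sigma^R_{S,\zeta}$ is well defined since $\Phi_n(q)$ is divisible by $q-\zeta$ in $R[\zeta][q]$ and the other generators become units in $R[\zeta][[q-\zeta]]$ (i.e. it is the map induced on completions). *)

(* Defs.v *)
From HB Require Import structures.
From mathcomp Require Import all_boot all_order all_algebra all_field.
Set Implicit Arguments. Unset Strict Implicit. Unset Printing Implicit Defensive.
Import Order.TTheory GRing.Theory Num.Theory.
Local Open Scope ring_scope.

Definition rdvd (A : comNzRingType) (f g : A) : Prop := exists h : A, g = h * f.

Definition PhiR (R : comNzRingType) (n : nat) : {poly R} :=
  map_poly (fun z : int => z%:~R) 'Phi_n.

Definition padic_separated (R : comNzRingType) (p : nat) : Prop :=
  forall x : R, (forall j : nat, exists y : R, x = (p%:R) ^+ j * y) -> x = 0.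

Definition rel_R (R : comNzRingType) (m m' : nat) : Prop :=
  m = m'
  \/ (exists p e : nat, prime p /\ padic_separated R p /\
        (m = m' * p ^ e \/ m' = m * p ^ e)%N)
  \/ (forall x : R, x = 0).

Definition rel_R_chain (R : comNzRingType) (S : nat -> Prop) (m m' : nat) : Prop :=
  exists s : seq nat,
    (forall a, a \in s -> S a) /\
    (forall i, (i < size s)%N -> rel_R R (nth m (m :: s) i) (nth m s i)) /\
    last m s = m'.

Definition rel_R_connected (R : comNzRingType) (S : nat -> Prop) : Prop :=
  (exists m, S m) /\ (forall m m', S m -> S m' -> rel_R_chain R S m m').

Definition in_PhiS (R : comNzRingType) (S : nat -> Prop) (f : {poly R}) : Prop :=
  exists s : seq nat, (forall m, m \in s -> S m) /\ f = \prod_(m <- s) PhiR R m.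

(* Elements of R[q]^S = lim_{f in Phi_S^*} R[q]/(f), represented as families
   x f of representatives of classes in R[q]/(f), compatible along divisibility. *)
Definition compatible (R : comNzRingType) (S : nat -> Prop)
    (x : {poly R} -> {poly R}) : Prop :=
  forall f g, in_PhiS S f -> in_PhiS S g -> rdvd f g -> rdvd f (x g - x f).

Definition limS_eq (R : comNzRingType) (S : nat -> Prop)
    (x y : {poly R} -> {poly R}) : Prop :=
  forall f, in_PhiS S f -> rdvd f (x f - y f).

Definition in_Rzeta (R : comNzRingType) (K : fieldType) (iota : {rmorphism R -> K})
    (zeta : K) (a : K) : Prop :=
  exists p : {poly R}, a = (map_poly iota p).[zeta].

Definition dvd_in_Rzeta_q (R : comNzRingType) (K : fieldType) (iota : {rmorphism R -> K})
    (zeta : K) (k : nat) (g : {poly K}) : Prop :=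
  exists h : {poly K}, (forall i, in_Rzeta iota zeta h`_i) /\
    g = h * ('X - zeta%:P) ^+ k.

(* sigma^R_{S,zeta}(x) = sigma^R_{S,zeta}(y) in R[zeta][[q-zeta]]
   = lim_k R[zeta][q]/((q-zeta)^k).  The k-th component of sigma(x) is the image
   of the component of x at Phi_n^k (in Phi_S^* since n in S) under
   R[q]/(Phi_n^k) -> R[zeta][q]/((q-zeta)^k). *)
Definition sigma_eq (R : comNzRingType) (K : fieldType) (iota : {rmorphism R -> K})
    (n : nat) (zeta : K) (x y : {poly R} -> {poly R}) : Prop :=
  forall k : nat,
    dvd_in_Rzeta_q iota zeta k
      (map_poly iota (x (PhiR R n ^+ k) - y (PhiR R n ^+ k))).

(* Main.v *)
Require Import Defs.
From HB Require Import structures.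
From mathcomp Require Import all_boot all_order all_algebra all_field.
From mathcomp Require Import ring boolp.
Import Order.TTheory GRing.Theory Num.Theory.
Import Pdiv.CommonRing Pdiv.RingMonic.
Local Open Scope ring_scope.

Set Implicit Arguments.
Unset Strict Implicit.
Unset Printing Implicit Defensive.

(* Let d be the difference of two elements of R[q]^S with the same image under
   sigma.  If g is monic, R is p-adically separated and f is nilpotent modulo
   (p, g), then R[q]/(g^l), being a free R-module of finite rank, is f-adically
   separated; hence d vanishes at all F g^l as soon as it vanishes at all F f^K.
   This vanishing propagates along chains.  Over R[zeta] it goes from q - zeta
   to all q - zeta^a, changing one primary component of a mod n at a time:
   (q - zeta^a)^(p^e) and (q - zeta^b)^(p^e) agree mod p when zeta^a / zeta^b
   has order dividing p^e.  So d vanishes at the powers of Phi_n, first over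
   R[zeta] and then over R.  Over R it goes from Phi_n to all Phi_m with m in S,
   because Phi_(m p^e) is congruent to a positive power of Phi_m mod p. *)

(** * Divisibility and binomial congruences in a commutative ring *)

Section Divisibility.
Variable A : comNzRingType.
Implicit Types f g h x y u v w : A.

Lemma rdvd0 f : rdvd f 0.
Proof. by exists 0; rewrite mul0r. Qed.

Lemma rdvdD f x y : rdvd f x -> rdvd f y -> rdvd f (x + y).
Proof. by case=> u -> [v ->]; exists (u + v); rewrite mulrDl. Qed.

Lemma rdvdN f x : rdvd f x -> rdvd f (- x).
Proof. by case=> u ->; exists (- u); rewrite mulNr. Qed.

Lemma rdvdB f x y : rdvd f x -> rdvd f y -> rdvd f (x - y).
Proof. by move=> fx fy; apply: rdvdD fx (rdvdN fy). Qed.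

Lemma rdvd_trans f g h : rdvd f g -> rdvd g h -> rdvd f h.
Proof. by case=> u -> [v ->]; exists (v * u); rewrite mulrA. Qed.

Lemma rdvd_mulr f g : rdvd f (f * g).
Proof. by exists g; rewrite mulrC. Qed.

Lemma rdvd_mull f g : rdvd f (g * f).
Proof. by exists g. Qed.

Lemma rdvd_mul f1 f2 g1 g2 : rdvd f1 g1 -> rdvd f2 g2 -> rdvd (f1 * f2) (g1 * g2).
Proof. by case=> u -> [v ->]; exists (u * v); rewrite mulrACA. Qed.

Lemma rdvd_exp2l f j k : (j <= k)%N -> rdvd (f ^+ j) (f ^+ k).
Proof. by move=> lejk; exists (f ^+ (k - j)); rewrite -exprD subnK. Qed.

Lemma rdvd_subM f x1 x2 y1 y2 :
  rdvd f (x1 - y1) -> rdvd f (x2 - y2) -> rdvd f (x1 * x2 - y1 * y2).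
Proof.
case=> u Du [v Dv]; exists (x1 * v + u * y2).
by rewrite mulrDl -mulrA -Dv mulrAC -Du; ring.
Qed.

Lemma rdvd_subX f x y k : rdvd f (x - y) -> rdvd f (x ^+ k - y ^+ k).
Proof.
move=> fxy; elim: k => [|k IHk]; first by rewrite subrr; apply: rdvd0.
by rewrite !exprS; apply: rdvd_subM.
Qed.

Lemma expr_add_ideal x y u v k :
  exists u' v', (u * x + v * y) ^+ k = u' * x + v' * y ^+ k.
Proof.
elim: k => [|k [u' [v' Dk]]]; first by exists 0, 1; rewrite mul0r add0r mulr1.
exists (u' * (u * x + v * y) + v' * y ^+ k * u), (v' * v).
by rewrite exprSr Dk exprSr; ring.
Qed.

Lemma freshman_sub p x y e : prime p ->
  rdvd p%:R ((x - y) ^+ (p ^ e) - (x ^+ (p ^ e) - y ^+ (p ^ e))).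
Proof.
move=> p_pr.
have base (a b : A) : rdvd p%:R ((a - b) ^+ p - (a ^+ p - b ^+ p)).
  (* Expanding a = c + b, with c = a - b, avoids the sign of (-b)^p, so p = 2 is no special case. *)
  rewrite -[in a ^+ p](subrK b a); move: (a - b) => c.
  rewrite exprDn; case: p p_pr => [|[|q]] // p_pr.
  rewrite big_ord_recl big_ord_recr /= subn0 bin0 subnn binn expr0 mul1r mulr1.
  rewrite !mulr1n.
  have E (s t r : A) : s - (s + (t + r) - r) = - t by ring.
  rewrite E; apply: rdvdN; elim/big_ind: _ => [||i _]; [exact: rdvd0|exact: rdvdD|].
  have /dvdnP[k ->] : (q.+2 %| 'C(q.+2, bump 0 i))%N.
    by apply: prime_dvd_bin => //; rewrite /bump /= ltnS.
  by rewrite mulrnA -[X in rdvd _ X]mulr_natr; apply: rdvd_mull.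
elim: e => [|e IHe]; first by rewrite expn0 !expr1 subrr; apply: rdvd0.
rewrite expnSr !exprM.
have := rdvdD (rdvd_subX p IHe) (base (x ^+ (p ^ e)) (y ^+ (p ^ e))).
by rewrite addrA subrK.
Qed.

End Divisibility.

(** * Adic separation and propagation of vanishing *)

Section AdicPropagation.
Variable A : comNzRingType.
Implicit Types f g z : {poly A}.

(** Division with remainder by the monic [g] is linear over [A], so every coefficient of the
    remainder of [z] is divisible by all powers of p. *)
Lemma padic_separated_mod p g z : g \is monic -> padic_separated A p ->
  (forall N, exists u v, z = u * p%:R ^+ N + v * g) -> rdvd g z.
Proof.
move=> g_mon sepA zP; suff z0 : rmodp z g = 0.
  by exists (rdivp z g); rewrite {1}(rdivp_eq g_mon z) z0 addr0.
apply/polyP=> i; rewrite coef0; apply: sepA => N.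
have [u [v ->]] := zP N; exists (rmodp u g)`_i.
rewrite rmodpD // rmodp_mull // addr0 -natrX mulr_natr -scaler_nat rmodpZ //.
by rewrite coefZ natrX.
Qed.

(** Nilpotence of [f] modulo (p, g). The relation is oriented: vanishing passes from [f] to [g]. *)
Definition radical_adjacent f g : Prop :=
  exists p : nat, padic_separated A p /\
    exists M u v, f ^+ M = u * p%:R + v * g.

(* Since f is topologically nilpotent in the p-adic topology of A[q]/(g^l),
   the f-adic topology there is separated. *)
Lemma radical_adjacent_separated f g l z :
  g \is monic -> radical_adjacent f g ->
  (forall K, exists u v, z = u * f ^+ K + v * g ^+ l) -> rdvd (g ^+ l) z.
Proof.
move=> g_mon [p [sepA [M [u [v Df]]]]] zP.
apply: (@padic_separated_mod p) => // [|N]; first exact: monic_exp.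
have [u1 [v1 Df1]] := expr_add_ideal p%:R g u v l.
have [v2 [u2 Df2]] := expr_add_ideal (g ^+ l) p%:R v1 u1 N.
(* f^M lies in (p, g), hence f^(M l) in (p, g^l), hence f^(M l N) in (p^N, g^l). *)
have [s [t ->]] := zP (M * l * N)%N.
rewrite !exprM Df Df1 addrC in Df2 *.
exists (s * u2), (s * v2 + t).
by rewrite Df2; ring.
Qed.

Variables (I : eqType) (S : I -> Prop) (phi : I -> {poly A}).
(** Indexing by lists of factors covers two uses: products of cyclotomic polynomials over R, and
    products of linear factors over R[zeta], where [d] depends only on the length of the list. *)
Variable d : seq I -> {poly A}.
Let F s := \prod_(i <- s) phi i.
Let inS (T : I -> Prop) (s : seq I) := forall i, i \in s -> T i.

Hypothesis phi_monic : forall i, S i -> phi i \is monic.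
Hypothesis d_compat : forall s t u, inS S u -> perm_eq u (s ++ t) ->
  rdvd (F s) (d u - d s).

Let F_monic s : inS S s -> F s \is monic.
Proof.
by move=> sS; rewrite /F big_seq; apply: rpred_prod => i /sS/phi_monic.
Qed.

Definition vanishes_on (T : I -> Prop) : Prop :=
  forall s, inS T s -> rdvd (F s) (d s).

Lemma vanishes_on_adjacent (T : seq I) i j : inS S T -> i \in T -> S j ->
  radical_adjacent (phi i) (phi j) -> vanishes_on (fun k => k \in T) ->
  vanishes_on (fun k => k \in j :: T).
Proof.
move=> TS iT Sj adj_ij vT s sjT.
pose s1 := [seq k <- s | k != j]; pose l := count_mem j s.
have s1T : inS (fun k => k \in T) s1.
  move=> k; rewrite mem_filter => /andP[kj /sjT]; rewrite inE.
  by rewrite (negPf kj).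
have iS := TS _ iT.
have s1S : inS S s1 by move=> k /s1T/TS.
have perm_s : perm_eq s (s1 ++ nseq l j).
  rewrite perm_sym perm_catC.
  have /all_pred1P : all (pred1 j) [seq k <- s | k == j] by apply: filter_all.
  by rewrite size_filter => <-; rewrite perm_filterC.
have FE : F s = F s1 * phi j ^+ l.
  by rewrite /F (perm_big _ perm_s) big_cat big_nseq /= -Monoid.iteropE.
have sS : inS S s by move=> k /sjT; rewrite inE => /predU1P[->|/TS].
have key K : exists u v, d s = u * (F s1 * phi i ^+ K) + v * F s.
  pose si := s1 ++ nseq K i.
  have siT : inS (fun k => k \in T) si.
    by move=> k; rewrite mem_cat => /orP[/s1T//|]; rewrite mem_nseq => /andP[_ /eqP->].
  (* Up to order [w] extends both [s] and [si], so [d w] links [d s] to [d si]. *)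
  pose w := s ++ nseq K i.
  have wS : inS S w.
    by move=> k; rewrite mem_cat => /orP[/sS//|]; rewrite mem_nseq => /andP[_ /eqP->].
  have [a Da] := d_compat wS (perm_refl _).
  have pw : perm_eq w (si ++ nseq l j).
    apply: (perm_trans (_ : perm_eq _ ((s1 ++ nseq l j) ++ nseq K i))).
      by rewrite perm_cat2r.
    by rewrite /si -!catA perm_cat2l perm_catC.
  have [b Db] := d_compat wS pw.
  have [c Dc] := vT _ siT.
  have FsiE : F si = F s1 * phi i ^+ K.
    by rewrite /F big_cat big_nseq /= -Monoid.iteropE.
  exists (b + c), (- a); rewrite -FsiE mulrDl -Db -Dc mulNr -Da; ring.
have [c Dc] : rdvd (F s1) (d s).
  have [u [v ->]] := key 0; rewrite FE; exists (u + v * phi j ^+ l).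
  by rewrite expr0; ring.
rewrite FE Dc mulrC; apply: rdvd_mul; last by exists 1; rewrite mul1r.
apply: radical_adjacent_separated adj_ij _ => [|K]; first exact: phi_monic.
have [u [v Duv]] := key K; exists u, v; apply: (monic_lreg (F_monic s1S)).
rewrite mulrC -Dc Duv FE; ring.
Qed.

(** The last hypothesis encodes reachability impredicatively: a property of [i0] preserved along
    adjacency holds at [j]. As a list has finitely many entries, it suffices to enlarge, chain by
    chain, a finite set of indices on which [d] vanishes. *)
Lemma vanishes_on_connected i0 :
  S i0 -> (forall k, rdvd (phi i0 ^+ k) (d (nseq k i0))) ->
  (forall j, S j -> forall Q : I -> Prop, Q i0 ->
    (forall a b, S b -> radical_adjacent (phi a) (phi b) -> Q a -> Q b) ->
    Q j) ->
  vanishes_on S.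
Proof.
move=> Si0 v0 conn.
pose vT (T : seq I) := inS S T /\ vanishes_on (fun k => k \in T).
have extend j T : S j -> vT T -> i0 \in T ->
    exists T', vT T' /\ {subset j :: T <= T'}.
  move=> Sj; move: T; apply: (conn j Sj (fun j => forall T, vT T -> i0 \in T ->
    exists T', vT T' /\ {subset j :: T <= T'})) => [T vTT i0T|a b Sb adj IH T vTT i0T].
    by exists T; split=> // k; rewrite inE => /predU1P[->|].
  have [T' [[T'S vT'] sT']] := IH T vTT i0T.
  exists (b :: T'); split; last first.
    move=> k; rewrite !inE => /predU1P[->|kT]; rewrite ?eqxx //.
    by rewrite sT' ?orbT // inE kT orbT.
  split; first by move=> k; rewrite inE => /predU1P[->|/T'S].
  by apply: vanishes_on_adjacent adj vT' => //; rewrite sT' ?mem_head.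
have base : vT [:: i0].
  split=> [k|s]; first by rewrite inE => /eqP->.
  move=> s0; have -> : s = nseq (size s) i0.
    by apply/all_pred1P/allP=> k /s0; rewrite inE.
  by rewrite /F big_nseq -Monoid.iteropE; apply: v0.
have all_s s : inS S s -> exists T, vT T /\ {subset i0 :: s <= T}.
  elim: s => [|j s IH] sS; first by exists [:: i0]; split.
  have [|T [vTT sT]] := IH; first by move=> k ks; apply: sS; rewrite inE ks orbT.
  have [T' [vT' sT']] := extend j T (sS _ (mem_head _ _)) vTT (sT _ (mem_head _ _)).
  exists T'; split=> // k; rewrite !inE => /or3P[/eqP->|/eqP->|ks];
    by rewrite sT' // inE ?eqxx // sT ?orbT // inE ?eqxx ?ks ?orbT.
move=> s sS; have [T [[_ vT'] sT]] := all_s s sS.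
by apply: vT' => k ks; rewrite sT // inE ks orbT.
Qed.

End AdicPropagation.

(** * Congruences between cyclotomic polynomials modulo a prime *)

(** If h g = c u and u = a g + r, then (h - c a) g = c r has degree below that of the monic [g],
    which forces h = c a. *)
Lemma rdvd_nat_monic_cancel (A : comNzRingType) (c : nat) (g h : {poly A}) :
  g \is monic -> rdvd c%:R (h * g) -> rdvd c%:R h.
Proof.
move=> g_mon [u Du]; exists (rdivp u g).
apply/eqP; rewrite -subr_eq0 -(rdiv0p g); apply/eqP.
rewrite -[LHS](@rdivp_addl_mul_small _ g g_mon _ (- (rmodp u g *+ c))).
  congr rdivp; rewrite mulrBl Du mulrAC {1}(rdivp_eq g_mon u) -mulr_natr; ring.
rewrite size_polyN (leq_ltn_trans _ (_ : (size (rmodp u g) < _)%N)) //.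
  by rewrite -scaler_nat size_scale_leq.
by rewrite ltn_rmodpN0 // monic_neq0.
Qed.

Lemma perm_divisors_mul_prime p m : prime p -> (0 < m)%N ->
  perm_eq (divisors (m * p))
    ([seq d * p | d <- divisors m]%N ++ [seq d <- divisors m | ~~ (p %| d)%N]).
Proof.
move=> p_pr m_gt0; have p_gt0 := prime_gt0 p_pr.
apply: uniq_perm => [||d]; first exact: divisors_uniq.
  rewrite cat_uniq filter_uniq ?divisors_uniq // andbT map_inj_uniq ?divisors_uniq //=.
    apply/hasPn=> d; rewrite mem_filter => /andP[pNd _].
    by apply: contra pNd => /mapP[k _ ->]; rewrite dvdn_mull.
  by move=> i j /eqP; rewrite eqn_pmul2r // => /eqP.
rewrite mem_cat mem_filter -!dvdn_divisors ?muln_gt0 ?m_gt0 //.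
have [/dvdnP[k ->]|pNd] := boolP (p %| d)%N; rewrite ?orbF /=.
  rewrite dvdn_pmul2r // (@mem_map _ _ (muln^~ p)); first by rewrite -dvdn_divisors.
  by move=> i j /eqP; rewrite eqn_pmul2r // => /eqP.
rewrite Gauss_dvdl ?[in LHS]orbC; last by rewrite coprime_sym prime_coprime.
case: (_ %| m)%N; rewrite ?orbT // orbF; apply/esym/mapP=> -[k _ Dd].
by rewrite Dd dvdn_mull in pNd.
Qed.

(** X^(m p) - 1 and (X^m - 1)^p are congruent modulo p, and are products over d dividing m of [G d]
    and of Phi_d^p. By induction the factors for d < m agree modulo p; the product of these Phi_d^p
    is monic and cancels. *)
Lemma Cyclotomic_mul_prime p m : prime p -> (0 < m)%N ->
  rdvd p%:R ('Phi_(m * p) * (if (p %| m)%N then 1 else 'Phi_m) - 'Phi_m ^+ p).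
Proof.
move=> p_pr; elim/ltn_ind: m => m IHm m_gt0.
(* [E d] accounts for the divisors of m p that are prime to p; the others have the form d p. *)
pose E d := if (p %| d)%N then 1 else 'Phi_d.
pose G d := 'Phi_(d * p) * E d.
have prodG : \prod_(d <- divisors m) G d = 'X^(m * p) - 1.
  rewrite -prod_Cyclotomic ?muln_gt0 ?m_gt0 ?prime_gt0 //.
  rewrite (perm_big _ (perm_divisors_mul_prime p_pr m_gt0)) big_cat big_map big_filter /=.
  rewrite big_split /=; congr (_ * _).
  by rewrite [RHS]big_mkcond; apply: eq_bigr => d _; rewrite /E; case: ifP.
have m_div : m \in divisors m by rewrite divisors_id.
have rest (f : nat -> {poly int}) :
    \prod_(d <- divisors m) f d = f m * \prod_(d <- divisors m | d != m) f d.
  by rewrite (bigD1_seq m) ?divisors_uniq.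
apply: (@rdvd_nat_monic_cancel _ p (\prod_(d <- divisors m | d != m) 'Phi_d ^+ p)).
  by apply: monic_prod => d _; apply: monic_exp; apply: Cyclotomic_monic.
have cong_rest : rdvd p%:R (\prod_(d <- divisors m | d != m) G d
                   - \prod_(d <- divisors m | d != m) 'Phi_d ^+ p).
  rewrite big_seq_cond [X in _ - X]big_seq_cond.
  apply: (big_rec2 (fun x y => rdvd p%:R (x - y))) => [|d x y].
    by rewrite subrr; apply: rdvd0.
  rewrite -dvdn_divisors // => /andP[d_m dNm] xy.
  apply: rdvd_subM => //; apply: IHm; last exact: dvdn_gt0 d_m.
  by rewrite ltn_neqAle dNm dvdn_leq.
have cong_all : rdvd p%:R (\prod_(d <- divisors m) G d
                   - \prod_(d <- divisors m) 'Phi_d ^+ p).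
  rewrite prodG prodrXl prod_Cyclotomic // -opprB; apply: rdvdN.
  have := freshman_sub ('X^m : {poly int}) 1 1 p_pr.
  by rewrite expn1 expr1n -exprM.
rewrite !rest -/(G m) in cong_all *.
set P := \prod_(_ <- _ | _) _ in cong_all cong_rest *.
set P' := \prod_(_ <- _ | _) _ in cong_all cong_rest *.
have -> : (G m - 'Phi_m ^+ p) * P' =
          (G m * P - 'Phi_m ^+ p * P') - G m * (P - P') by ring.
apply: rdvdB cong_all _; case: cong_rest => u ->.
by rewrite mulrA; apply: rdvd_mull.
Qed.

(** Each factor p multiplies the exponent by p or p - 1, according to whether p already divides the
    index. *)
Lemma Cyclotomic_mul_prime_exp p e m : prime p -> (0 < m)%N ->
  exists J, rdvd p%:R ('Phi_(m * p ^ e) - 'Phi_m ^+ J) /\ (0 < J)%N.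
Proof.
move=> p_pr m_gt0; elim: e => [|e [J [IHe J_gt0]]].
  by exists 1%N; rewrite expn0 muln1 expr1 subrr; split=> //; apply: rdvd0.
have p_gt1 := prime_gt1 p_pr.
rewrite expnSr mulnA; set n := (m * p ^ e)%N in IHe *.
have n_gt0 : (0 < n)%N by rewrite muln_gt0 m_gt0 expn_gt0 prime_gt0.
have [k k_gt0 Dk] : exists2 k, (0 < k)%N & rdvd p%:R ('Phi_(n * p) - 'Phi_n ^+ k).
  have := Cyclotomic_mul_prime p_pr n_gt0; case: ifP => _; rewrite ?mulr1.
    by exists p => //; apply: prime_gt0.
  exists p.-1; first by rewrite -ltnS prednK // prime_gt0.
  apply: (@rdvd_nat_monic_cancel _ p 'Phi_n); first exact: Cyclotomic_monic.
  by rewrite mulrBl -exprSr prednK // prime_gt0.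
exists (J * k)%N; split; last by rewrite muln_gt0 J_gt0.
have := rdvdD Dk (rdvd_subX k IHe).
by rewrite -exprM addrA subrK.
Qed.

(** * Cyclotomic polynomials over a commutative ring *)

Lemma rdvd_rmorph (A B : comNzRingType) (f : {rmorphism A -> B}) a b :
  rdvd a b -> rdvd (f a) (f b).
Proof. by case=> u ->; exists (f u); rewrite rmorphM. Qed.

Lemma PhiR_monic (A : comNzRingType) n : PhiR A n \is monic.
Proof. exact/monic_map/Cyclotomic_monic. Qed.

Lemma size_PhiR (A : comNzRingType) n : size (PhiR A n) = (totient n).+1.
Proof.
by rewrite size_map_poly_id0 ?size_Cyclotomic // (monicP (Cyclotomic_monic n)) oner_neq0.
Qed.

Lemma map_PhiR (A B : comNzRingType) (f : {rmorphism A -> B}) n :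
  map_poly f (PhiR A n) = PhiR B n.
Proof.
rewrite /PhiR -map_poly_comp; apply: eq_map_poly => z /=.
by rewrite rmorph_int.
Qed.

(** The congruence of Phi_(m p^e) with Phi_m^J modulo p serves both directions: it puts Phi_m^J in
    (p, Phi_(m p^e)) and, as J > 0, Phi_(m p^e) in (p, Phi_m). *)
Lemma rel_R_radical_adjacent (R : comNzRingType) m m' : (0 < m)%N -> (0 < m')%N ->
  rel_R R m m' -> m = m' \/ radical_adjacent (PhiR R m) (PhiR R m').
Proof.
move=> m_gt0 m'_gt0 [->|[[p [e [p_pr [sepR mm']]]]|R0]]; first by left.
  right; exists p; split=> //.
  have cong n : (0 < n)%N -> exists J,
      rdvd p%:R (PhiR R (n * p ^ e) - PhiR R n ^+ J) /\ (0 < J)%N.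
    move=> n_gt0; have [J [cJ J_gt0]] := Cyclotomic_mul_prime_exp e p_pr n_gt0.
    exists J; split=> //; have := rdvd_rmorph (map_poly (intr : int -> R)) cJ.
    by rewrite rmorph_nat rmorphB rmorphXn.
  case: mm' => ->.
    have [[|J] [[u Du] //]] := cong m' m'_gt0.
    exists 1%N, u, (PhiR R m' ^+ J).
    by rewrite expr1 -Du -exprSr subrK.
  have [J [[u Du] _]] := cong m m_gt0.
  by exists J, (- u), 1; rewrite mulNr -Du; ring.
by case/eqP: (oner_neq0 R); apply: R0.
Qed.

(** * The ring R[zeta] and its p-adic separation *)

Section AdjoinRoot.
Variables (R : comNzRingType) (K : fieldType) (iota : {rmorphism R -> K}) (zeta : K).

(** Classical truth values make membership boolean, so that R[zeta] is a subtype of [K] inheriting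
    its ring structure. *)
Definition Rzeta_pred : {pred K} := fun a => `[< in_Rzeta iota zeta a >].

Lemma Rzeta_subring_closed : subring_closed Rzeta_pred.
Proof.
split=> [|_ _ /asboolP[f ->] /asboolP[g ->]|_ _ /asboolP[f ->] /asboolP[g ->]];
  apply/asboolP.
- by exists 1; rewrite rmorph1 hornerC.
- by exists (f - g); rewrite rmorphB hornerD hornerN.
- by exists (f * g); rewrite rmorphM hornerM.
Qed.

HB.instance Definition _ := GRing.isSubringClosed.Build K Rzeta_pred Rzeta_subring_closed.

Record Rzeta : Type := MkRzeta { Rzeta_val :> K; _ : Rzeta_val \in Rzeta_pred }.

HB.instance Definition _ := [isSub for Rzeta_val].
HB.instance Definition _ := [Choice of Rzeta by <:].
HB.instance Definition _ := [SubChoice_isSubComNzRing of Rzeta by <:].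

Lemma Rzeta_in (a : Rzeta) : in_Rzeta iota zeta (val a).
Proof. exact/asboolP/(valP a). Qed.

Lemma Rzeta_of_subproof (r : R) : iota r \in Rzeta_pred.
Proof. by apply/asboolP; exists r%:P; rewrite map_polyC hornerC. Qed.

Definition Rzeta_of (r : R) : Rzeta := MkRzeta (Rzeta_of_subproof r).

Lemma Rzeta_of_zmod_morphism : zmod_morphism Rzeta_of.
Proof. by move=> x y; apply: val_inj; rewrite /= rmorphB. Qed.

Lemma Rzeta_of_monoid_morphism : monoid_morphism Rzeta_of.
Proof.
by split=> [|x y]; apply: val_inj; rewrite /= ?rmorph1 ?rmorphM.
Qed.

HB.instance Definition _ :=
  GRing.isZmodMorphism.Build R Rzeta Rzeta_of Rzeta_of_zmod_morphism.
HB.instance Definition _ :=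
  GRing.isMonoidMorphism.Build R Rzeta Rzeta_of Rzeta_of_monoid_morphism.

Lemma Rzeta_root_subproof : zeta \in Rzeta_pred.
Proof. by apply/asboolP; exists 'X; rewrite map_polyX hornerX. Qed.

Definition Rzeta_root : Rzeta := MkRzeta Rzeta_root_subproof.

Lemma map_val_Rzeta_of (f : {poly R}) :
  map_poly val (map_poly Rzeta_of f) = map_poly iota f.
Proof. by rewrite -map_poly_comp; apply: eq_map_poly. Qed.

End AdjoinRoot.

(* R[zeta] need not be free over R, but if c is the leading coefficient of a
   nonzero polynomial P of minimal degree d killing zeta, then some c^m R[zeta]
   lies in the free module spanned by 1, ..., zeta^(d-1). *)
Lemma Rzeta_padic_separated (R : idomainType) (K : fieldType)
    (iota : {rmorphism R -> K}) (zeta : K) (p : nat) (P0 : {poly R}) :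
  injective iota -> P0 \is monic -> root (map_poly iota P0) zeta ->
  padic_separated R p -> padic_separated (Rzeta iota zeta) p.
Proof.
move=> iota_inj P0_mon P0_root sepR x xP.
pose ev h := (map_poly iota h).[zeta].
have evD f g : ev (f + g) = ev f + ev g by rewrite /ev rmorphD hornerD.
have evM f g : ev (f * g) = ev f * ev g by rewrite /ev rmorphM hornerM.
have evZ a g : ev (a *: g) = iota a * ev g by rewrite /ev map_polyZ hornerZ.
have ev0 : ev P0 = 0 by apply/rootP.
have [P [P_neq0 evP P_min]] : exists P : {poly R}, [/\ P != 0, ev P = 0 &
    forall Q, ev Q = 0 -> (size Q < size P)%N -> Q = 0].
  pose kills m := `[< exists P : {poly R}, [/\ P != 0, ev P = 0 & size P = m] >].
  have ex_kills : exists m, kills m.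
    by exists (size P0); apply/asboolP; exists P0; rewrite monic_neq0.
  case: (ex_minnP ex_kills) => m /asboolP[P [P_neq0 evP sP]] m_min.
  exists P; split=> // Q evQ; rewrite sP ltnNge; case: (eqVneq Q 0) => // Q_neq0.
  by rewrite m_min //; apply/asboolP; exists Q.
pose c := lead_coef P; pose dg := (size P).-1.
have sP : size P = dg.+1 by rewrite prednK // size_poly_gt0.
(* After one multiplication by [c], the top coefficient cancels against a multiple of [P]. *)
have reduce m (h : {poly R}) : (size h <= m + dg)%N ->
    exists2 r : {poly R}, (size r <= dg)%N & ev r = iota c ^+ m * ev h.
  elim: m h => [|m IHm] h sh; first by exists h; rewrite ?expr0 ?mul1r.
  have [|r sr evr] := IHm (c *: h - h`_(m + dg) *: ('X^m * P)).
    apply/leq_sizeP=> j; rewrite leq_eqVlt => /predU1P[<-|lt_j].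
      rewrite coefB !coefZ coefXnM ltnNge leq_addr /= addKn /c /lead_coef sP.
      by rewrite mulrC subrr.
    rewrite coefB !coefZ coefXnM [h`_j]nth_default ?(leq_trans sh) // mulr0 sub0r.
    case: ifP => _; rewrite ?mulr0 ?oppr0 // [P`_ _]nth_default ?mulr0 ?oppr0 //.
    by rewrite sP ltn_subRL.
  exists r => //; rewrite evr evD -scaleNr !evZ evM evP !mulr0 addr0 mulrA.
  by rewrite exprSr.
(* Reducing modulo the monic [P0] first bounds the degree, so one power of [c] serves all of
   R[zeta]. *)
have normal (b : Rzeta iota zeta) :
    exists2 r : {poly R}, (size r <= dg)%N & ev r = iota c ^+ size P0 * val b.
  have [h Dh] := Rzeta_in b.
  have -> : val b = ev (rmodp h P0).
    by rewrite Dh -/(ev h) {1}(rdivp_eq P0_mon h) evD evM ev0 mulr0 add0r.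
  apply: reduce; apply: leq_trans (leq_addr _ _); apply: ltnW.
  by rewrite ltn_rmodpN0 ?monic_neq0.
have [r sr Dr] := normal x.
have r0 : r = 0.
  apply/polyP=> i; rewrite coef0; apply: sepR => j.
  have [y Dy] := xP j; have [t st Dt] := normal y; exists t`_i.
  (* This difference kills zeta and has size at most [dg], so it vanishes by minimality of [P]. *)
  suff /subr0_eq -> : r - p%:R ^+ j *: t = 0 by rewrite coefZ.
  apply: P_min; last first.
    rewrite sP ltnS (leq_trans (size_polyD _ _)) // geq_max sr size_polyN.
    exact: leq_trans (size_scale_leq _ _) st.
  rewrite evD -scaleNr evZ Dr Dt Dy rmorphN rmorphM !rmorphXn !rmorph_nat /=.
  ring.
apply/val_inj/eqP; rewrite /=; move/eqP: Dr.
rewrite r0 {1}/ev map_poly0 horner0 eq_sym mulf_eq0 expf_eq0.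
rewrite -(rmorph0 iota) (inj_eq iota_inj).
by rewrite lead_coef_eq0 (negPf P_neq0) andbF.
Qed.

(** * Units modulo n and their primary components *)

Lemma coprimeP_prime a n : (0 < n)%N ->
  (forall p, prime p -> (p %| n)%N -> ~~ (p %| a)%N) -> coprime a n.
Proof.
move=> n_gt0 noP; rewrite /coprime; set g := gcdn a n.
have g_gt0 : (0 < g)%N by rewrite gcdn_gt0 n_gt0 orbT.
rewrite eqn_leq g_gt0 andbT leqNgt; apply/negP=> g_gt1.
have /negP[] := noP _ (pdiv_prime g_gt1) (dvdn_trans (pdiv_dvd g) (dvdn_gcdr _ _)).
exact: dvdn_trans (pdiv_dvd g) (dvdn_gcdl _ _).
Qed.

(* The units 1 and b mod n are joined by changing their p-primary components
   one prime at a time.  The 2-primary component is trivial unless 4 | n. *)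
Lemma coprime_primary_chain n b (Q : nat -> Prop) : (0 < n)%N -> coprime b n ->
  Q 1%N -> (forall a a', a = a' %[mod n] -> Q a -> Q a') ->
  (forall p a a', prime p -> (p %| n)%N -> odd p || (4 %| n)%N ->
     coprime a' n -> a = a' %[mod n`_p^'] -> Q a -> Q a') ->
  Q b.
Proof.
move=> n_gt0 co_b Q1 Qmod Qstep.
pose lt k : nat_pred := [pred p | (p < k)%N].
(* [c k] is congruent to [b] at the primes below [k] and to 1 at the others. *)
pose c k := chinese n`_(lt k) n`_(lt k)^' b 1.
have cE k p : p \in \pi(n) -> c k = (if (p < k)%N then b else 1%N) %[mod n`_p].
  move=> pn; have co := coprime_partC (lt k) n n.
  have part_dvd (pi : nat_pred) : p \in pi -> (n`_p %| n`_pi)%N.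
    by move=> p_pi; apply: sub_in_partn => q _; rewrite !inE => /eqP->.
  have modW m x y : (n`_p %| m)%N -> x = y %[mod m] -> x = y %[mod n`_p].
    by move=> dv xy; rewrite -(modn_dvdm x dv) xy modn_dvdm.
  case: ifP => lt_pk;
    [apply: modW (chinese_modl co _ _)|apply: modW (chinese_modr co _ _)];
    by apply: part_dvd; rewrite !inE ?lt_pk.
have dvd_part p : prime p -> (p %| n)%N -> (p %| n`_p)%N.
  by move=> p_pr pn; rewrite p_part dvdn_exp // logn_gt0 mem_primes p_pr n_gt0.
have co_c k : coprime (c k) n.
  apply: coprimeP_prime => // p p_pr pn.
  have p_pi : p \in \pi(n) by rewrite mem_primes p_pr n_gt0.
  rewrite /dvdn -(modn_dvdm (c k) (dvd_part p p_pr pn)) (cE k p p_pi).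
  rewrite modn_dvdm ?dvd_part // -/(dvdn p _); case: ifP => _.
    by rewrite -prime_coprime // (coprime_dvdl pn) // coprime_sym.
  by rewrite dvdn1 neq_ltn prime_gt1 ?orbT.
have Qc k : Q (c k).
  elim: k => [|k IHk].
    by apply: Qmod Q1; apply/esym/eqP/modn_partP=> // p pn; rewrite cE.
  have same p : p \in \pi(n) -> p != k -> c k = c k.+1 %[mod n`_p].
    by move=> pn pk; rewrite !cE // ltnS (leq_eqVlt p) (negPf pk).
  have [/andP[/andP[k_pr kn] oddk]|not_step] :=
      boolP [&& prime k && (k %| n)%N & odd k || (4 %| n)%N].
    apply: (Qstep k) IHk => //; apply/eqP/modn_partP=> // p.
    rewrite pi_of_part // !inE => /andP[pn pk].
    by rewrite partn_part ?same // => q; rewrite !inE => /eqP->.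
  (* The only component that could change is at p = 2 with n twice an odd number, where all units
     agree modulo 2. *)
  apply: Qmod IHk; apply/eqP/modn_partP=> // p pn.
  have [pk|] := eqVneq p k; last exact: same.
  move: (pn); rewrite mem_primes n_gt0 /= => /andP[p_pr p_n].
  move: not_step; rewrite -pk p_pr p_n /= negb_or => /andP[p_even n4].
  have p2 : p = 2%N by case: (even_prime p_pr) => // p_odd; rewrite p_odd in p_even.
  have -> : (n`_p = 2)%N.
    rewrite p_part p2; have -> : logn 2 n = 1%N; last by [].
    apply/eqP; rewrite eqn_leq logn_gt0 -p2 pn andbT leqNgt p2.
    by rewrite -(@pfactor_dvdn 2 2 n).
  have odd_c j : odd (c j).
    by have := co_c j; rewrite coprime_sym => /(coprime_dvdl p_n); rewrite p2 coprime2n.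
  by rewrite !modn2 !odd_c.
apply: Qmod (Qc n.+1); apply/eqP/modn_partP=> // p pn; rewrite cE //.
by rewrite ltnS dvdn_leq //; move: pn; rewrite mem_primes => /and3P[].
Qed.

(** * Roots of cyclotomic polynomials in a field *)

(** As a root of X^n - 1, [z] is a root of Phi_d for some d dividing n; then z^d = 1, and
    primitivity gives d = n. *)
Lemma prim_root_PhiR (K : fieldType) n (z : K) :
  n.-primitive_root z -> root (PhiR K n) z.
Proof.
move=> z_prim; have n_gt0 := prim_order_gt0 z_prim.
have prodPhi m : (0 < m)%N -> \prod_(d <- divisors m) PhiR K d = 'X^m - 1.
  move=> m_gt0; rewrite -(rmorph_prod (map_poly (intr : int -> K))) prod_Cyclotomic //.
  by rewrite rmorphB rmorph1 /= map_polyXn.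
have root_Xn m : (0 < m)%N -> root (\prod_(d <- divisors m) PhiR K d) z = (n %| m)%N.
  by move=> m_gt0; rewrite prodPhi // rootE !hornerE subr_eq0 -(prim_order_dvd z_prim).
have rootP_divisors m : root (\prod_(d <- divisors m) PhiR K d) z =
    has (fun d => root (PhiR K d) z) (divisors m).
  elim: (divisors m) => [|d ds IHds]; first by rewrite big_nil; apply: negbTE (root1 z).
  by rewrite big_cons rootM IHds.
have : root (\prod_(d <- divisors n) PhiR K d) z by rewrite root_Xn.
rewrite rootP_divisors => /hasP[d]; rewrite -dvdn_divisors // => d_n root_d.
have d_gt0 := dvdn_gt0 n_gt0 d_n.
suff /(dvdn_leq d_gt0) le_nd : (n %| d)%N.
  suff -> : n = d by [].
  by apply/eqP; rewrite eqn_leq le_nd dvdn_leq.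
rewrite -root_Xn // rootP_divisors; apply/hasP; exists d => //.
by rewrite divisors_id.
Qed.

(** These powers of [z] are [totient n] distinct roots of a monic polynomial of that degree. *)
Lemma PhiR_prim_root (K : fieldType) n (z : K) : n.-primitive_root z ->
  PhiR K n = \prod_(w <- [seq z ^+ k | k <- iota 0 n & coprime k n]) ('X - w%:P).
Proof.
move=> z_prim; set rs := map _ _.
have sz_rs : size rs = totient n.
  rewrite size_map size_filter -sum1_count totient_count_coprime.
  rewrite big_mkcond /= /index_iota subn0; apply: eq_bigr => k _.
  by rewrite coprime_sym; case: (coprime n k).
have -> : PhiR K n = lead_coef (PhiR K n) *: \prod_(w <- rs) ('X - w%:P).
  apply: all_roots_prod_XsubC.
  - by rewrite sz_rs size_PhiR.
  - apply/allP=> w /mapP[k]; rewrite mem_filter => /andP[co_k _] ->.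
    by apply: prim_root_PhiR; rewrite prim_root_exp_coprime.
  - rewrite uniq_rootsE map_inj_in_uniq ?filter_uniq ?iota_uniq // => i j.
    rewrite !mem_filter !mem_iota !add0n => /andP[_ i_n] /andP[_ j_n] /eqP.
    by rewrite (eq_prim_root_expr z_prim) !modn_small // => /eqP.
by rewrite (monicP (PhiR_monic K n)) scale1r.
Qed.

(** * Vanishing at the powers of Phi_n *)

(** Division by a monic polynomial commutes with ring morphisms, so the remainder of [g] maps to
    zero, and is zero by injectivity. *)
Lemma rdvd_map_monic (A B : comNzRingType) (j : {rmorphism A -> B}) (f g : {poly A}) :
  injective j -> f \is monic -> rdvd (map_poly j f) (map_poly j g) -> rdvd f g.
Proof.
move=> j_inj f_mon [u Du]; have jf_mon := monic_map j f_mon.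
have sz_j (h : {poly A}) : size (map_poly j h) = size h.
  by apply: size_map_inj_poly; rewrite ?rmorph0.
suff r0 : rmodp g f = 0 by exists (rdivp g f); rewrite {1}(rdivp_eq f_mon g) r0 addr0.
apply/eqP; rewrite -size_poly_eq0 -sz_j size_poly_eq0.
rewrite -[map_poly j _](@rmodp_small _ _ (map_poly j f)); last first.
  by rewrite !sz_j ltn_rmodpN0 // monic_neq0.
have -> : map_poly j (rmodp g f) = (u - map_poly j (rdivp g f)) * map_poly j f.
  rewrite mulrBl -Du -rmorphM -rmorphB; congr map_poly.
  by apply/eqP; rewrite eq_sym subr_eq addrC -rdivp_eq.
by rewrite rmodp_mull.
Qed.

Lemma vanishing_at_prim_root (R B : comNzRingType) (K : fieldType)
    (toB : {rmorphism R -> B}) (toK : {rmorphism B -> K}) (z : B) (n : nat)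
    (d : nat -> {poly R}) :
  injective toB -> injective toK -> n.-primitive_root (toK z) ->
  (forall p, prime p -> (p %| n)%N -> odd p || (4 %| n)%N -> padic_separated B p) ->
  (forall j k, (j <= k)%N -> rdvd (PhiR R n ^+ j) (d k - d j)) ->
  (forall k, rdvd (('X - z%:P) ^+ k) (map_poly toB (d k))) ->
  forall k, rdvd (PhiR R n ^+ k) (d k).
Proof.
move=> toB_inj toK_inj z_prim sepB d_compat d_vanish.
have n_gt0 := prim_order_gt0 z_prim.
pose dB k := map_poly toB (d k).
pose rs : seq B := [seq z ^+ k | k <- iota 0 n & coprime k n].
have PhiB : PhiR B n = \prod_(w <- rs) ('X - w%:P).
  apply: (map_inj_poly toK_inj (rmorph0 _)).
  rewrite map_PhiR (PhiR_prim_root z_prim) rmorph_prod !big_map.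
  by apply: eq_bigr => k _; rewrite /= map_polyXsubC [in RHS]rmorphXn.
have dB_compat j k : (j <= k)%N -> rdvd (PhiR B n ^+ j) (dB k - dB j).
  move=> /d_compat/(rdvd_rmorph (map_poly toB)).
  by rewrite rmorphXn rmorphB /= map_PhiR.
pose S (w : B) := exists2 a, coprime a n & w = z ^+ a.
have z_mod a b : a = b %[mod n] -> z ^+ a = z ^+ b.
  move=> ab; apply: toK_inj; rewrite !rmorphXn /=; apply/eqP.
  by rewrite (eq_prim_root_expr z_prim) ab.
have rdvd_Phi w : S w -> rdvd ('X - w%:P) (PhiR B n).
  case=> a co_a ->; rewrite -(z_mod _ _ (modn_mod a n)) PhiB.
  rewrite (big_rem (z ^+ (a %% n))) /=; first exact: rdvd_mulr.
  apply/mapP; exists (a %% n)%N => //.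
  by rewrite mem_filter coprime_modl co_a mem_iota /= ltn_mod.
(* A product of [size s] factors q - w divides Phi_n^(size s), so [dB (size s)] represents the
   component at that product. *)
have vS : vanishes_on (fun w : B => 'X - w%:P) (fun s => dB (size s)) S.
  apply: (@vanishes_on_connected B B S _ _ _ _ z).
  - by move=> w _; apply: monicXsubC.
  - move=> s t u uS pu; have [] : rdvd (\prod_(w <- s) ('X - w%:P)) (PhiR B n ^+ size s).
      have sS w : w \in s -> S w.
        by move=> ws; apply: uS; rewrite (perm_mem pu) mem_cat ws.
      elim: s sS {pu} => [|w s IHs] sS.
        by rewrite big_nil expr0; exists 1; rewrite mulr1.
      rewrite big_cons /= exprS; apply: rdvd_mul; first exact/rdvd_Phi/sS/mem_head.
      by apply: IHs => v vs; apply: sS; rewrite inE vs orbT.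
    move=> v Dv; apply: rdvd_trans (dB_compat _ _ _); first by exists v.
    by rewrite (perm_size pu) size_cat leq_addr.
  - by exists 1%N; rewrite ?coprime1n ?expr1.
  - by move=> k; rewrite size_nseq.
  - move=> w [b co_b ->] Q Q1 Qadj.
    pose Q' a := Q (z ^+ a).
    apply: (@coprime_primary_chain n b Q') => //; rewrite /Q' ?expr1 //.
      by move=> a a' /z_mod->.
    move=> p a a' p_pr pn odd_p co_a' aa'; apply: Qadj; first by exists a'.
    exists p; split; first exact: sepB.
    (* Multiplying a congruence modulo the prime-to-p part of n by the p-part gives one modulo n. *)
    have zz' : (z ^+ a) ^+ (p ^ logn p n) = (z ^+ a') ^+ (p ^ logn p n).
      rewrite -!exprM -p_part; apply: z_mod.
      have modM m : (a * m = a' * m %[mod m * n`_p^'])%N.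
        by rewrite ![(_ * m)%N]mulnC -!muln_modr aa'.
      by have := modM (n`_p)%N; rewrite partnC.
    (* Modulo p, the p^e-th powers of q - z^a and q - z^a' both become q^(p^e) minus the same
       constant. *)
    have frob c := freshman_sub 'X (z ^+ c)%:P (logn p n) p_pr.
    have [u Du] := rdvdB (frob a) (frob a').
    have : (p ^ logn p n > 0)%N by rewrite expn_gt0 prime_gt0.
    move: zz' u Du; case: (p ^ logn p n)%N => // M zz' u Du _.
    exists M.+1, u, (('X - (z ^+ a')%:P) ^+ M).
    by rewrite -Du -exprSr -!rmorphXn /= zz'; ring.
move=> k; apply: (rdvd_map_monic toB_inj); first exact/monic_exp/PhiR_monic.
rewrite rmorphXn /= map_PhiR -/(dB k).
have rsS w : w \in rs -> S w.
  by case/mapP=> a; rewrite mem_filter => /andP[co_a _] ->; exists a.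
(* The product over [s] is Phi_n^k, but its length is only known to be at least [k]; compatibility
   then brings [dB (size s)] back to [dB k]. *)
pose s := flatten (nseq k rs).
have sS w : w \in s -> S w.
  by case/flattenP=> t; rewrite mem_nseq => /andP[_ /eqP->] /rsS.
have Fs : \prod_(w <- s) ('X - w%:P) = PhiR B n ^+ k.
  rewrite /s; elim: (k) => [|m IHm]; first by rewrite big_nil.
  by rewrite /= big_cat /= IHm -PhiB exprS.
have rs_gt0 : (0 < size rs)%N.
  by rewrite -ltnS -(size_prod_XsubC rs id) -PhiB size_PhiR ltnS totient_gt0.
have sz_s : (k <= size s)%N.
  rewrite /s; elim: (k) => // m IHm; rewrite /= size_cat -add1n leq_add //.
have := rdvdB (vS s sS) (_ : rdvd _ (dB (size s) - dB k)).
rewrite Fs subKr; apply; exact: dB_compat.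
Qed.

(** The case B = R[zeta]: the cofactors in K[q] have coefficients in R[zeta], so the divisibility by
    (q - zeta)^k already holds in R[zeta][q]. *)
Lemma sigma_injective_at (R : idomainType) (n : nat) (K : fieldType)
    (iota : {rmorphism R -> K}) (zeta : K) (d : nat -> {poly R}) :
  (forall p : nat, prime p -> odd p -> (p %| n)%N -> padic_separated R p) ->
  ((4 %| n)%N -> padic_separated R 2) ->
  injective iota -> n.-primitive_root zeta ->
  (forall j k, (j <= k)%N -> rdvd (PhiR R n ^+ j) (d k - d j)) ->
  (forall k, dvd_in_Rzeta_q iota zeta k (map_poly iota (d k))) ->
  forall k, rdvd (PhiR R n ^+ k) (d k).
Proof.
move=> sep_odd sep2 iota_inj z_prim d_compat d_sigma.
pose B := Rzeta iota zeta; pose z : B := Rzeta_root iota zeta.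
pose toB : {rmorphism R -> B} := Rzeta_of iota zeta.
pose toK : {rmorphism B -> K} := val.
have toK_inj : injective toK := val_inj.
have toB_inj : injective toB by move=> r s /(congr1 toK)/iota_inj.
have sepB p : padic_separated R p -> padic_separated B p.
  apply: (Rzeta_padic_separated iota_inj (PhiR_monic R n)).
  by rewrite map_PhiR prim_root_PhiR.
have zB_prim : n.-primitive_root (toK z) := z_prim.
apply: (@vanishing_at_prim_root R B K toB toK z n d) => // [p p_pr pn odd_p|k].
  apply: sepB; case: (even_prime p_pr) => [p2|p_odd]; last exact: sep_odd.
  by rewrite p2 /= in odd_p *; apply: sep2.
have [h [hB Dh]] := d_sigma k.
(* The default 0 is never taken, since the coefficients of [h] lie in R[zeta]. *)
pose h' : {poly B} := \poly_(i < size h) insubd (0 : B) h`_i.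
exists h'; apply: (map_inj_poly toK_inj (rmorph0 _)).
rewrite rmorphM rmorphXn /= (map_polyXsubC toK).
rewrite [LHS](map_val_Rzeta_of iota zeta) Dh; congr (_ * _).
apply/polyP=> i; rewrite [RHS](coef_map toK) coef_poly.
case: ltnP => [_|sz_i]; last by rewrite nth_default // rmorph0.
by rewrite [RHS]insubdK //; apply/asboolP.
Qed.

(** * Injectivity of sigma for a connected set *)

(** The difference [D] is propagated twice: over R[zeta] to reach the powers of Phi_n, then over R
    along chains in [S]. *)
Lemma limS_eq_of_sigma_eq (R : idomainType) (S : nat -> Prop) (n : nat)
    (K : fieldType) (iota : {rmorphism R -> K}) (zeta : K) :
  (forall m, S m -> (0 < m)%N) -> rel_R_connected R S -> S n ->
  (forall p : nat, prime p -> odd p -> (p %| n)%N -> padic_separated R p) ->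
  ((4 %| n)%N -> padic_separated R 2) ->
  injective iota -> n.-primitive_root zeta ->
  forall x y : {poly R} -> {poly R},
    compatible S x -> compatible S y ->
    sigma_eq iota n zeta x y -> limS_eq S x y.
Proof.
move=> S_gt0 [_ connS] Sn sep_odd sep2 iota_inj z_prim x y x_compat y_compat sxy.
pose D f := x f - y f.
have D_compat f g : in_PhiS S f -> in_PhiS S g -> rdvd f g -> rdvd f (D g - D f).
  move=> fS gS fg; have := rdvdB (x_compat _ _ fS gS fg) (y_compat _ _ fS gS fg).
  by congr rdvd; rewrite /D; ring.
have PhiS_prod s : (forall m, m \in s -> S m) -> in_PhiS S (\prod_(m <- s) PhiR R m).
  by move=> sS; exists s.
have prod_nseq k : \prod_(m <- nseq k n) PhiR R m = PhiR R n ^+ k.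
  by rewrite big_nseq -Monoid.iteropE.
have PhiS_exp k : in_PhiS S (PhiR R n ^+ k).
  by rewrite -prod_nseq; apply: PhiS_prod => m; rewrite mem_nseq => /andP[_ /eqP->].
have vS : vanishes_on (PhiR R) (fun s => D (\prod_(m <- s) PhiR R m)) S.
  apply: (@vanishes_on_connected R _ S _ _ _ _ n) => //.
  - by move=> m _; apply: PhiR_monic.
  - move=> s t u uS pu; apply: D_compat; try apply: PhiS_prod => //.
      by move=> m ms; apply: uS; rewrite (perm_mem pu) mem_cat ms.
    by rewrite (perm_big _ pu) big_cat; apply: rdvd_mulr.
  - move=> k; rewrite prod_nseq.
    apply: (@sigma_injective_at R n K iota zeta (fun k => D (PhiR R n ^+ k))) => //.
    move=> j l le_jl; apply: D_compat => //; exact: rdvd_exp2l.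
  (* Induction on the list, with a variable starting point, turns a chain into the required
     reachability. *)
  - move=> m Sm Q Qn Qadj; have [s [sS [rel_s last_s]]] := connS n m Sn Sm.
    rewrite -last_s; move: (n) Sn Qn rel_s {last_s}.
    elim: s sS => [|b s IHs] sS a Sa Qa rel_s //=.
    have Sb := sS b (mem_head _ _).
    apply: IHs => //.
    + by move=> c cs; apply: sS; rewrite inE cs orbT.
    + have [<-//|adj] := rel_R_radical_adjacent (S_gt0 _ Sa) (S_gt0 _ Sb) (rel_s 0 isT).
      exact: Qadj adj Qa.
    move=> i lt_i; have := rel_s i.+1 lt_i.
    rewrite /= [nth a s i](set_nth_default b) // [nth a _ i](set_nth_default b) //.
    exact: ltnW.
by move=> f [s [sS ->]]; apply: vS.
Qed.

(** * Separation and connectedness for the integers, and the final statement *)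

(** A nonzero x has absolute value below p^|x|, so it is not divisible by that power. *)
Lemma int_padic_separated p : prime p -> padic_separated int p.
Proof.
move=> p_pr x xP; apply/eqP; rewrite -absz_eq0; apply/eqP.
have [y Dy] := xP `|x|%N.
have : (p ^ `|x| %| `|x|)%N.
  by rewrite {2}Dy abszM abszX natz dvdn_mulr.
case: (posnP `|x|%N) => // x_gt0 /(dvdn_leq x_gt0).
by rewrite leqNgt ltn_expl // prime_gt1.
Qed.

(** Remove the prime factors of m one at a time down to 1, then insert those of m' one at a time. *)
Lemma int_positive_connected : rel_R_connected int (fun m => (0 < m)%N).
Proof.
split; first by exists 1%N.
pose chain := rel_R_chain int (fun m => (0 < m)%N).
have chain_refl a : chain a a by exists [::]; split.
have chain_cons a b c : (0 < b)%N -> rel_R int a b -> chain b c -> chain a c.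
  move=> b_gt0 ab [s [sS [s_rel <-]]]; exists (b :: s); split.
    by move=> k; rewrite inE => /predU1P[->|/sS].
  split=> // -[|i] //= lt_i; have := s_rel i lt_i.
  by rewrite [nth b s i](set_nth_default a) // [nth b _ i](set_nth_default a) // ltnW.
have rel_prime p a : prime p -> rel_R int a (a * p) /\ rel_R int (a * p) a.
  by move=> p_pr; have sep := int_padic_separated p_pr;
     split; right; left; exists p, 1%N; rewrite expn1; auto.
have factor m : (1 < m)%N -> exists p k,
    [/\ prime p, m = (k * p)%N, (0 < k)%N & (k < m)%N].
  move=> m_gt1; have p_pr := pdiv_prime m_gt1; have /dvdnP[k Dm] := pdiv_dvd m.
  have k_gt0 : (0 < k)%N by case: (k) Dm m_gt1 => // ->.
  exists (pdiv m), k; split=> //.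
  by rewrite Dm -[X in (X < _)%N]muln1 ltn_pmul2l // prime_gt1.
have down m c : (0 < m)%N -> chain 1%N c -> chain m c.
  elim/ltn_ind: m => m IHm m_gt0 ch1; case: (ltngtP m 1) => [|m_gt1|->//].
    by rewrite ltnS leqn0 => /eqP m0; rewrite m0 in m_gt0.
  have [p [k [p_pr Dm k_gt0 lt_km]]] := factor m m_gt1.
  by apply: (chain_cons _ k) => //; [rewrite Dm; case: (rel_prime p k p_pr)|apply: IHm].
have up m a : (0 < a)%N -> (0 < m)%N -> chain a (a * m)%N.
  elim/ltn_ind: m a => m IHm a a_gt0 m_gt0; case: (ltngtP m 1) => [|m_gt1|->].
  - by rewrite ltnS leqn0 => /eqP m0; rewrite m0 in m_gt0.
  - have [p [k [p_pr Dm k_gt0 lt_km]]] := factor m m_gt1.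
    have ap_gt0 : (0 < a * p)%N by rewrite muln_gt0 a_gt0 prime_gt0.
    apply: (chain_cons _ (a * p)%N) => //; first by case: (rel_prime p a p_pr).
    by rewrite Dm mulnCA [(k * _)%N]mulnC; apply: IHm.
  by rewrite muln1.
by move=> m m' m_gt0 m'_gt0; apply: down => //; rewrite -[m']mul1n; apply: up.
Qed.

Theorem theorem5p4 :
  (forall (R : idomainType) (S : nat -> Prop) (n : nat)
     (K : fieldType) (iota : {rmorphism R -> K}) (zeta : K),
     [pchar R] =i pred0 ->
     (forall m, S m -> (0 < m)%N) ->
     rel_R_connected R S ->
     S n ->
     (forall p : nat, prime p -> odd p -> (p %| n)%N -> padic_separated R p) ->
     ((4 %| n)%N -> padic_separated R 2) ->
     injective iota ->
     n.-primitive_root zeta ->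
     forall x y : {poly R} -> {poly R},
       compatible S x -> compatible S y ->
       sigma_eq iota n zeta x y -> limS_eq S x y)
  /\
  (forall (K : fieldType) (iota : {rmorphism int -> K}) (zeta : K) (n : nat),
     injective iota ->
     (0 < n)%N -> n.-primitive_root zeta ->
     forall x y : {poly int} -> {poly int},
       compatible (fun m => (0 < m)%N) x -> compatible (fun m => (0 < m)%N) y ->
       sigma_eq iota n zeta x y -> limS_eq (fun m => (0 < m)%N) x y).
Proof.
split=> [R S n K iota zeta _|K iota zeta n iota_inj n_gt0 z_prim].
  exact: limS_eq_of_sigma_eq.
apply: limS_eq_of_sigma_eq z_prim => // [|p p_pr _ _|_].
- exact: int_positive_connected.
- exact: int_padic_separated.
- exact: int_padic_separated.
Qed.
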